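(* There exist $n$, symmetric matrices $Q_0,Q_1,Q_2\in\mathbb{R}^{n\times n}$, vectors $b_0,b_1,b_2\in\mathbb{R}^n$ and scalars $c_1,c_2\in\mathbb{R}$ such that the problem $$\min_{x\in\mathbb{R}^n}\{x^TQ_0x+2b_0^Tx:\ x^TQ_1x+2b_1^Tx+c_1\le 0,\ x^TQ_2x+2b_2^Tx+c_2\le 0\}$$ has a strict local non-global minimizer at which the standard second-order sufficient optimality condition does not hold.
   Context: A strict local non-global minimizer is a strict local minimizer (objective value strictly smaller than that of all other feasible points in some neighbourhood) that is not a global minimizer. Write $f_0(x)=x^TQ_0x+2b_0^Tx$ and $f_i(x)=x^TQ_ix+2b_i^Tx+c_i$ for $i=1,2$. The standard second-order sufficient optimality condition at a feasible $x^*$ is: there exist multipliers $\alpha_1,\alpha_2\ge 0$ with $\nabla f_0(x^* )+\alpha_1\nabla f_1(x^* )+\alpha_2\nabla f_2(x^* )=0$ and $\alpha_if_i(x^* )=0$ ($i=1,2$), such that $v^T(Q_0+\alpha_1Q_1+\alpha_2Q_2)v>0$ for every $v\ne0$ satisfying $v^T\nabla f_i(x^* )=0$ for each $i$ with $\alpha_i>0$, and $v^T\nabla f_i(x^* )\le 0$ for each $i$ with $f_i(x^* )=0$ and $\alpha_i=0$. *)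

(* Defs.v *)
From mathcomp Require Import all_boot all_order all_algebra.
From mathcomp Require Import boolp classical_sets reals topology normedtype derive.

Set Implicit Arguments.
Unset Strict Implicit.
Unset Printing Implicit Defensive.

Import Order.TTheory GRing.Theory Num.Theory.
Import numFieldNormedType.Exports.

Local Open Scope classical_set_scope.
Local Open Scope ring_scope.

Definition quadratic (R : realType) n (Q : 'M[R]_n) (b : 'cV[R]_n) (c : R)
    (x : 'cV[R]_n) : R :=
  (x^T *m Q *m x) 0 0 + 2 * (b^T *m x) 0 0 + c.

Definition grad (R : realType) n (f : 'cV[R]_n -> R) (x : 'cV[R]_n) : 'cV[R]_n :=
  \col_i 'D_(delta_mx i 0) f x.

Definition dotv (R : realType) n (u v : 'cV[R]_n) : R := (u^T *m v) 0 0.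

Definition feasible (R : realType) n (f1 f2 : 'cV[R]_n -> R) : set 'cV[R]_n :=
  [set x | f1 x <= 0 /\ f2 x <= 0].

(* Neighbourhoods come from the max norm on 'cV[R]_n, whose topology is the
   Euclidean one. *)
Definition strict_local_minimizer (R : realType) n (F : set 'cV[R]_n)
    (f : 'cV[R]_n -> R) (x : 'cV[R]_n) : Prop :=
  F x /\ \forall y \near x, F y -> y != x -> f x < f y.

Definition global_minimizer (R : realType) n (F : set 'cV[R]_n)
    (f : 'cV[R]_n -> R) (x : 'cV[R]_n) : Prop :=
  F x /\ forall y, F y -> f x <= f y.

Definition strict_local_nonglobal_minimizer (R : realType) n (F : set 'cV[R]_n)
    (f : 'cV[R]_n -> R) (x : 'cV[R]_n) : Prop :=
  strict_local_minimizer F f x /\ ~ global_minimizer F f x.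

Definition critical_for (R : realType) n (f : 'cV[R]_n -> R) (a : R)
    (x v : 'cV[R]_n) : Prop :=
  (0 < a -> dotv v (grad f x) = 0) /\
  (f x = 0 -> a = 0 -> dotv v (grad f x) <= 0).

(* Q0 + a1 Q1 + a2 Q2 is half the Hessian of the Lagrangian. Feasibility of x
   is not part of this condition. *)
Definition second_order_sufficient (R : realType) n (Q0 Q1 Q2 : 'M[R]_n)
    (b0 b1 b2 : 'cV[R]_n) (c1 c2 : R) (x : 'cV[R]_n) : Prop :=
  let f0 := quadratic Q0 b0 0 in
  let f1 := quadratic Q1 b1 c1 in
  let f2 := quadratic Q2 b2 c2 in
  exists a1 a2 : R,
    [/\ 0 <= a1 /\ 0 <= a2,
        grad f0 x + a1 *: grad f1 x + a2 *: grad f2 x = 0,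
        a1 * f1 x = 0 /\ a2 * f2 x = 0 &
        forall v : 'cV[R]_n, v != 0 ->
          critical_for f1 a1 x v -> critical_for f2 a2 x v ->
          0 < (v^T *m (Q0 + a1 *: Q1 + a2 *: Q2) *m v) 0 0].

(* Main.v *)
Require Import Defs.
From mathcomp Require Import all_boot all_order all_algebra.
From mathcomp Require Import boolp classical_sets reals topology normedtype derive.
From mathcomp Require Import ring lra.

(** The example lives in dimension 3. With coordinates (u, v, w), minimize
    v - u^2 + v^2 - w subject to u^2 - v <= 0 and w - w^2 <= 0.

    The second constraint says that w <= 0 or w >= 1, so near the origin it
    reads w <= 0. There the objective (v - u^2) + v^2 - w is a sum of three
    nonnegative terms, which vanish together only at the origin: the origin is
    a strict local minimizer, of value 0. The point (0, 0, 1) of the other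
    component has value -1, so the origin is not a global minimizer.

    At the origin the gradients of the constraints are (0, -1, 0) and
    (0, 0, 1), and that of the objective is (0, 1, -1), so both multipliers
    must be 1. The critical directions are then the multiples of (1, 0, 0),
    along which the curvature -1 of the objective cancels the curvature 1 of
    the first constraint. The growth of the objective along the curve v = u^2
    is quartic, which no second-order condition can detect. The constraint
    gradients are independent and strict complementarity holds, so the failure
    of the sufficient condition is one of curvature and not of
    multipliers. *)

Local Open Scope classical_set_scope.
Local Open Scope ring_scope.

Import Order.TTheory GRing.Theory Num.Theory.
Import numFieldNormedType.Exports.

Lemma quadratic0 (R : realType) n (Q : 'M[R]_n) (b : 'cV[R]_n) c :
  quadratic Q b c 0 = c.
Proof. by rewrite /quadratic !mulmx0 !mxE mulr0 !add0r. Qed.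

(** Along a line through the origin the difference quotient is affine in the
    step h, with constant term 2 b^T v. *)
Lemma derive_quadratic0 (R : realType) n (Q : 'M[R]_n) (b : 'cV[R]_n) c v :
  'D_v (quadratic Q b c) 0 = 2 * (b^T *m v) 0 0.
Proof.
rewrite /derive; apply: cvg_lim => //.
set q := (v^T *m Q *m v) 0 0; set l := (b^T *m v) 0 0.
have affine_cvg : (fun h : R => h * q + 2 * l) h @[h --> (0 : R)^'] --> 2 * l.
  have -> : nbhs (2 * l) = nbhs (0 * q + 2 * l) by rewrite mul0r add0r.
  by apply: cvgD; [apply: cvgMr_tmp; exact: nbhs_dnbhs | exact: cvg_cst].
apply: cvg_trans affine_cvg; apply: near_eq_cvg.
near=> h.
have h_neq0 : h != 0 by near: h; exact: nbhs_dnbhs_neq.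
rewrite /= quadratic0 addr0 /quadratic -!scalemxAr [(h *: v)^T]linearZ /=.
have entryZ (a : R) (A : 'M_1) : (a *: A) 0 0 = a * A 0 0 by rewrite mxE.
rewrite -!scalemxAl !entryZ -/q -/l /GRing.scale /=.
by field.
Unshelve. all: by end_near. Qed.

Lemma grad_quadratic0 (R : realType) n (Q : 'M[R]_n) (b : 'cV[R]_n) c :
  grad (quadratic Q b c) 0 = 2 *: b.
Proof.
apply/matrixP => i j; rewrite !mxE derive_quadratic0 (ord1 j).
by rewrite -colE !mxE.
Qed.

Lemma diag_formE (R : realType) n (q : 'rV[R]_n) (x : 'cV[R]_n) :
  (x^T *m diag_mx q *m x) 0 0 = \sum_i q 0 i * x i 0 ^+ 2.
Proof.
rewrite mul_mx_diag mxE; apply: eq_bigr => i _.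
by rewrite !mxE mulrAC mulrC expr2.
Qed.

Lemma sum_ord3 (R : realType) (F : 'I_3 -> R) :
  \sum_i F i = F 0 + F 1 + F 2.
Proof.
rewrite !big_ord_recl big_ord0 addr0 addrA.
by congr (F _ + F _ + F _); exact: val_inj.
Qed.

Definition row3 (R : realType) (a b c : R) : 'rV[R]_3 :=
  \row_(i < 3) [:: a; b; c]`_i.

Lemma quadratic_diag3E (R : realType) (p q r k l m c : R) (x : 'cV[R]_3) :
  quadratic (diag_mx (row3 R p q r)) (row3 R k l m)^T c x =
  p * x 0 0 ^+ 2 + q * x 1 0 ^+ 2 + r * x 2 0 ^+ 2
  + 2 * (k * x 0 0 + l * x 1 0 + m * x 2 0) + c.
Proof. by rewrite /quadratic diag_formE trmxK mxE !sum_ord3 !mxE. Qed.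

Lemma col3_eq0 (R : realType) (x : 'cV[R]_3) :
  x 0 0 = 0 -> x 1 0 = 0 -> x 2 0 = 0 -> x = 0.
Proof.
move=> x0 x1 x2; apply/matrixP => i j; rewrite (ord1 j) mxE.
by case: i => -[|[|[|//]]] i_lt3; [rewrite -x0|rewrite -x1|rewrite -x2];
  congr (x _ _); exact: val_inj.
Qed.

Section Example.
Variable R : realType.

Let Q0 : 'M[R]_3 := diag_mx (row3 R (-1) 1 0).
Let Q1 : 'M[R]_3 := diag_mx (row3 R 1 0 0).
Let Q2 : 'M[R]_3 := diag_mx (row3 R 0 0 (-1)).
Let b0 : 'cV[R]_3 := (row3 R 0 (1 / 2) (- (1 / 2)))^T.
Let b1 : 'cV[R]_3 := (row3 R 0 (- (1 / 2)) 0)^T.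
Let b2 : 'cV[R]_3 := (row3 R 0 0 (1 / 2))^T.
Let f0 := quadratic Q0 b0 0.
Let F := feasible (quadratic Q1 b1 0) (quadratic Q2 b2 0).

Lemma objectiveE x : f0 x = (x 1 0 - x 0 0 ^+ 2) + x 1 0 ^+ 2 - x 2 0.
Proof. by rewrite /f0 quadratic_diag3E; field. Qed.

Lemma feasibleP x : F x <-> x 0 0 ^+ 2 <= x 1 0 /\ x 2 0 <= x 2 0 ^+ 2.
Proof. by rewrite /F /feasible /= !quadratic_diag3E; split=> -[]; split; lra. Qed.

(** In the slab w < 1 the second constraint forces w <= 0. *)
Lemma origin_strict_local_minimizer : strict_local_minimizer F f0 0.
Proof.
split; first by apply/feasibleP; rewrite !mxE; split; lra.
have slab : \forall y \near (0 : 'cV[R]_3), (y : 'cV[R]_3) 2 0 < 1.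
  have cvg0 := @coord_continuous R 3 1 2 0 (0 : 'cV[R]_3).
  by apply: (cvgr_lt _ cvg0); rewrite mxE ltr01.
apply: filterS slab => y y2_lt1 /feasibleP[y01 y22] y_neq0.
rewrite !objectiveE !mxE.
have y2_le0 : y 2 0 <= 0 by nra.
rewrite ltNge; apply: contra_neqN y_neq0 => fy_le0.
have y1_sq := sqr_ge0 (y 1 0); have y0_sq := sqr_ge0 (y 0 0).
have y1_eq0 : y 1 0 = 0 by apply/eqP; rewrite -sqrf_eq0; apply/eqP; lra.
apply: col3_eq0 => //; last by lra.
by apply/eqP; rewrite -sqrf_eq0; apply/eqP; lra.
Qed.

Lemma origin_not_global_minimizer : ~ global_minimizer F f0 0.
Proof.
move=> [_ /(_ (row3 R 0 0 1)^T)]; rewrite !objectiveE !mxE /=.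
have far_feasible : F (row3 R 0 0 1)^T by apply/feasibleP; rewrite !mxE /=; lra.
by move=> /(_ far_feasible); lra.
Qed.

Lemma origin_not_second_order_sufficient :
  ~ second_order_sufficient Q0 Q1 Q2 b0 b1 b2 0 0 0.
Proof.
case=> a1 [a2 []] _; rewrite /critical_for !grad_quadratic0.
move=> stationary _ /(_ (row3 R 1 0 0)^T).
have a1E : a1 = 1.
  by have /matrixP/(_ 1 0) := stationary; rewrite !mxE /=; lra.
have a2E : a2 = 1.
  by have /matrixP/(_ 2 0) := stationary; rewrite !mxE /=; lra.
have dir_neq0 : (row3 R 1 0 0)^T != 0.
  by apply/eqP => /matrixP/(_ 0 0); rewrite !mxE /=; lra.
have orth1 : dotv (row3 R 1 0 0)^T (2 *: b1) = 0.
  by rewrite /dotv trmxK mxE sum_ord3 !mxE /=; lra.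
have orth2 : dotv (row3 R 1 0 0)^T (2 *: b2) = 0.
  by rewrite /dotv trmxK mxE sum_ord3 !mxE /=; lra.
rewrite orth1 orth2 lexx => /(_ dir_neq0 (conj (fun=> erefl) (fun _ _ => isT))).
move=> /(_ (conj (fun=> erefl) (fun _ _ => isT))).
rewrite a1E a2E !scale1r /Q0 /Q1 /Q2 -!raddfD /= diag_formE sum_ord3 !mxE /=.
by lra.
Qed.

End Example.

Theorem mainTheorem11 (R : realType) :
  exists (n : nat) (Q0 Q1 Q2 : 'M[R]_n) (b0 b1 b2 : 'cV[R]_n) (c1 c2 : R),
    [/\ Q0^T = Q0, Q1^T = Q1, Q2^T = Q2 &
      exists x : 'cV[R]_n,
        strict_local_nonglobal_minimizer
          (feasible (quadratic Q1 b1 c1) (quadratic Q2 b2 c2))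
          (quadratic Q0 b0 0) x /\
        ~ second_order_sufficient Q0 Q1 Q2 b0 b1 b2 c1 c2 x].
Proof.
exists 3, (diag_mx (row3 R (-1) 1 0)), (diag_mx (row3 R 1 0 0)),
  (diag_mx (row3 R 0 0 (-1))), (row3 R 0 (1 / 2) (- (1 / 2)))^T,
  (row3 R 0 (- (1 / 2)) 0)^T, (row3 R 0 0 (1 / 2))^T, 0, 0.
split; try exact: tr_diag_mx.
exists 0; split; last exact: origin_not_second_order_sufficient.
split; first exact: origin_strict_local_minimizer.
exact: origin_not_global_minimizer.
Qed.
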